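(* Consider a network system $\Sigma=\Sigma_1\times\dots\times\Sigma_N$ with $x_i^+=f_i(x_i,y_{\mathcal N_i},u_i,d_i)$, $y_i=h_i(x_i)$, $i=1,\dots,N$, equipped with a parameterized network assume-guarantee contract with templates $\varphi_{ae}^i,\varphi_{af}^i,\varphi_g^i$ and maps $\lambda_i:\mathcal P_{ae}^i\times\mathcal P_{af}^i\to\mathcal P_g^i$. Suppose: 1. For every $i$ and every $p_{ae}^i\in\mathcal P_{ae}^i$, $p_{af}^i\in\mathcal P_{af}^i$, subsystem $\Sigma_i$ satisfies its subcontract: $$\Sigma_i\wedge\varphi_{ae}^i(p_{ae}^i)\wedge\varphi_{af}^i(p_{af}^i)\ \preceq\ \varphi_g^i\big(\lambda_i(p_{ae}^i,p_{af}^i)\big).$$ 2. There is a map $\Gamma:\mathcal P_g\to\mathcal P_{af}$ such that, for all $p_g\in\mathcal P_g$ and all $i$, $$\varphi_g(p_g)\preceq\varphi_{af}^i(\gamma_i(p_g)),\qquad \gamma_i(p_g)=\Gamma(p_g)\downarrow\mathcal P_{af}^i .$$ 3. There are environment parameters $p_{ae}\in\mathcal P_{ae}$ such that $\varphi_{ae}(p_{ae})$ is satisfied. 4. There are feedback parameters $p_{af}[0]\in\mathcal P_{af}$ such that $\varphi_{af}(p_{af}[0])$ is satisfied. With $p_{ae}$ as in 3, put $p_{ae}^i=p_{ae}\downarrow\mathcal P_{ae}^i$, $\hat\lambda_i(\cdot)=\lambda_i(p_{ae}^i,\cdot)$ and $$\hat\Lambda(p_{af})=\big(\hat\lambda_1(p_{af}\downarrow\mathcal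 P_{af}^1),\dots,\hat\lambda_N(p_{af}\downarrow\mathcal P_{af}^N)\big)\in\mathcal P_g,$$ and define recursively, for $k=0,1,2,\dots$, $$p_g[k]=\hat\Lambda(p_{af}[k]),\qquad p_{af}[k+1]=\Gamma(p_g[k]).$$ Then the network system satisfies $$\hat\phi_g=\bigwedge_{k=0}^{\infty}\varphi_g(p_g[k]),$$ that is, every trajectory of the network that satisfies $\varphi_{ae}(p_{ae})$ and $\varphi_{af}(p_{af}[0])$ (as required by 3 and 4) satisfies $\varphi_g(p_g[k])$ for every $k\ge 0$.
   Context: **Network.** For $i=1,\dots,N$, subsystem $\Sigma_i$ is the discrete-time system $x_i^+=f_i(x_i,y_{\mathcal N_i},u_i,d_i)$, $y_i=h_i(x_i)$, with state $x_i\in\mathcal X_i\subseteq\mathbb R^{n_i}$, control $u_i\in\mathcal U_i\subseteq\mathbb R^{m_i}$, exogenous disturbance $d_i\in\mathcal D_i\subseteq\mathbb R^{l_i}$, output $y_i\in\mathcal Y_i\subseteq\mathbb R^{s_i}$; $\mathcal N_i$ is the set of indices of neighbours of $\Sigma_i$ and $y_{\mathcal N_i}$ is the stacked vector of $y_j$, $j\in\mathcal N_i$. A signal is a tuple of sequences $z(\cdot)=(x,y,u,d)(\cdot)$ indexed by discrete time $t=0,1,\dots$ with $x_i(t)\in\mathcal X_i$, $y_i(t)\in\mathcal Y_i$, $u_i(t)\in\mathcal U_i$, $d_i(t)\in\mathcal D_i$ for all $i$ and $t$. A signal satisfies $\Sigma_i$ if $x_i(t+1)=f_i(x_i(t),y_{\mathcal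 N_i}(t),u_i(t),d_i(t))$ and $y_i(t)=h_i(x_i(t))$ for all $t$. A trajectory of the network is a signal satisfying $\Sigma_i$ for every $i$. **Signal temporal logic (STL).** Formulas are given by $\phi=\top\mid\mu\mid\neg\phi\mid\phi_1\wedge\phi_2\mid\phi_1\mathbf U_I\phi_2$, where $\mu$ is a predicate on the instantaneous value of the signal and $I$ an interval. $(z,t)\models\mu$ iff $z(t)$ satisfies $\mu$; negation and conjunction are as usual; $(z,t)\models\phi_1\mathbf U_{[a,b]}\phi_2$ iff there is a (sampling) time $t'\in t+[a,b]$ with $(z,t')\models\phi_2$ and $(z,t'')\models\phi_1$ for all times $t''\in[t,t']$. $z(\cdot)\models\phi$ means $(z,0)\models\phi$. A parameterized STL (pSTL) template $\varphi$ on a parameter domain $\mathcal P$ assigns to each $p\in\mathcal P$ an STL formula $\varphi(p)$. Write $\phi_1\preceq\phi_2$ if every signal satisfying $\phi_1$ satisfies $\phi_2$; $\Sigma_i\wedge\phi_a\preceq\phi_g$ means every signal that satisfies $\Sigma_i$ and $\phi_a$ satisfies $\phi_g$. **Parameterized network assume-guarantee contract.** For each $i$ there are pSTL templates $\varphi_{ae}^i$ (environment assumption), $\varphi_{af}^i$ (feedback assumption), $\varphi_g^i$ (guarantee) on parameter domains $\mathcal P_{ae}^i,\mathcal P_{af}^i,\mathcal P_g^i$, and a map $\lambda_i:\mathcal P_{ae}^i\times\mathcal P_{af}^i\to\mathcal P_g^i$. The overall parameters $p_{ae}\in\mathcal P_{ae}$ and $p_{af}\in\mathcal P_{af}$ collect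 all the individual parameters $p_{ae}^i$, resp. $p_{af}^i$, where a parameter occurring in several subcontracts is listed only once; $p\downarrow\mathcal P_{af}^i$ (resp. $\mathcal P_{ae}^i$) denotes the projection onto the $i$-th subcontract's parameters. The overall guarantee parameter is $p_g=(p_g^1,\dots,p_g^N)\in\mathcal P_g$. Put $\varphi_{ae}(p_{ae})=\bigwedge_i\varphi_{ae}^i(p_{ae}\downarrow\mathcal P_{ae}^i)$, $\varphi_{af}(p_{af})=\bigwedge_i\varphi_{af}^i(p_{af}\downarrow\mathcal P_{af}^i)$, $\varphi_g(p_g)=\bigwedge_i\varphi_g^i(p_g^i)$. *)

(* Defs.v *)
From mathcomp Require Import all_boot all_order all_algebra.
From mathcomp Require Import classical_sets reals.

Set Implicit Arguments.
Unset Strict Implicit.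
Unset Printing Implicit Defensive.

Import Order.TTheory GRing.Theory Num.Theory.

Local Open Scope classical_set_scope.
Local Open Scope ring_scope.

(* The stacked vector of neighbour outputs is the family of the y_j indexed by
   the subtype of the neighbours j. The maps are total on the ambient vector
   spaces; only their values on the admissible sets matter, because signals
   stay in these sets. *)
Record network (R : realType) := Network {
  nsub : nat;
  dimx : 'I_nsub -> nat;
  dimu : 'I_nsub -> nat;
  dimd : 'I_nsub -> nat;
  dimy : 'I_nsub -> nat;
  statesp : forall i, set 'cV[R]_(dimx i);
  inputsp : forall i, set 'cV[R]_(dimu i);
  distsp : forall i, set 'cV[R]_(dimd i);
  outputsp : forall i, set 'cV[R]_(dimy i);
  nbr : 'I_nsub -> {set 'I_nsub};
  dyn : forall i, 'cV[R]_(dimx i) ->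
    (forall j : {j | j \in nbr i}, 'cV[R]_(dimy (sval j))) ->
    'cV[R]_(dimu i) -> 'cV[R]_(dimd i) -> 'cV[R]_(dimx i);
  out : forall i, 'cV[R]_(dimx i) -> 'cV[R]_(dimy i)
}.

Section Signals.
Variables (R : realType) (S : network R).

Record value := Value {
  vx : forall i, 'cV[R]_(@dimx R S i);
  vy : forall i, 'cV[R]_(@dimy R S i);
  vu : forall i, 'cV[R]_(@dimu R S i);
  vd : forall i, 'cV[R]_(@dimd R S i);
  vxP : forall i, statesp (vx i);
  vyP : forall i, outputsp (vy i);
  vuP : forall i, inputsp (vu i);
  vdP : forall i, distsp (vd i)
}.

Definition signal := nat -> value.

Definition satisfies_subsystem (i : 'I_(nsub S)) (z : signal) : Prop :=
  forall t : nat,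
    vx (z t.+1) i = dyn (vx (z t) i) (fun j => vy (z t) (sval j))
                        (vu (z t) i) (vd (z t) i)
    /\ vy (z t) i = out (vx (z t) i).

Definition trajectory (z : signal) : Prop :=
  forall i, satisfies_subsystem i z.

Inductive stl :=
| STop
| SPred of set value
| SNot of stl
| SAnd of stl & stl
| SUntil of interval R & stl & stl.

Fixpoint sat (z : signal) (t : nat) (phi : stl) : Prop :=
  match phi with
  | STop => True
  | SPred mu => mu (z t)
  | SNot phi1 => ~ sat z t phi1
  | SAnd phi1 phi2 => sat z t phi1 /\ sat z t phi2
  | SUntil J phi1 phi2 => exists t' : nat,
      [/\ t'%:R - t%:R \in J,
          sat z t' phi2
        & forall t'' : nat, (t <= t'' <= t')%N -> sat z t'' phi1]
  end.

Definition models (z : signal) (phi : stl) : Prop := sat z 0 phi.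

Definition stl_le (phi1 phi2 : stl) : Prop :=
  forall z : signal, models z phi1 -> models z phi2.

Definition subsystem_le (i : 'I_(nsub S)) (phia phig : stl) : Prop :=
  forall z : signal,
    satisfies_subsystem i z -> models z phia -> models z phig.

Definition conj_all (phi : 'I_(nsub S) -> stl) : stl :=
  \big[SAnd/STop]_(i < nsub S) phi i.

End Signals.

Arguments STop {R S}.

(* A family of N parameter domains that may share parameters. [pname] lists
   every parameter once, [pval k] is the range of the parameter k, and the
   i-th domain [pdom i] is a set of valuations of the parameters in [puses i]. *)
Record param_family (N : nat) := ParamFamily {
  pname : finType;
  pval : pname -> Type;
  puses : 'I_N -> {set pname};
  pcover : forall k, exists i, k \in puses i;
  pdom : forall i, set (forall k : {k | k \in puses i}, pval (sval k))
}.

Section OverallParam.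
Variables (N : nat) (P : param_family N).

Definition local_param (i : 'I_N) : Type := {p | @pdom N P i p}.

Definition restrict (i : 'I_N) (p : forall k : pname P, pval k) :
    forall k : {k | k \in @puses N P i}, pval (sval k) :=
  fun k => p (sval k).

Definition overall_param : Type :=
  {p : forall k : pname P, pval k | forall i, pdom (@restrict i p)}.

Definition proj (i : 'I_N) (p : overall_param) : local_param i :=
  exist _ (@restrict i (sval p)) (svalP p i).

End OverallParam.

Record contract (R : realType) (S : network R) := Contract {
  cae : param_family (nsub S);
  caf : param_family (nsub S);
  cg : 'I_(nsub S) -> Type;
  phi_ae : forall i, local_param cae i -> stl S;
  phi_af : forall i, local_param caf i -> stl S;
  phi_g : forall i, cg i -> stl S;
  lambda : forall i, local_param cae i * local_param caf i -> cg i
}.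

Section Contracts.
Variables (R : realType) (S : network R) (C : contract S).

Definition overall_g : Type := forall i, @cg R S C i.

Definition Phi_ae (p : overall_param (cae C)) : stl S :=
  conj_all (fun i => phi_ae (proj i p)).

Definition Phi_af (p : overall_param (caf C)) : stl S :=
  conj_all (fun i => phi_af (proj i p)).

Definition Phi_g (p : overall_g) : stl S := conj_all (fun i => phi_g (p i)).

Definition hat_Lambda (pae : overall_param (cae C))
    (paf : overall_param (caf C)) : overall_g :=
  fun i => lambda (proj i pae, proj i paf).

Variables (pae : overall_param (cae C)).
Variables (Gamma : overall_g -> overall_param (caf C)).
Variables (paf0 : overall_param (caf C)).

Fixpoint paf_seq (k : nat) : overall_param (caf C) :=
  if k is k'.+1 then Gamma (hat_Lambda pae (paf_seq k')) else paf0.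

Definition pg_seq (k : nat) : overall_g := hat_Lambda pae (paf_seq k).

End Contracts.

(* Main.v *)
(* With the environment parameters fixed, one round of the subcontracts turns
   the feedback assumption for paf_seq k into the guarantee for pg_seq k, which
   Gamma turns into the feedback assumption for paf_seq k.+1. *)

Require Import Defs.
From mathcomp Require Import all_boot all_order all_algebra.
From mathcomp Require Import classical_sets reals.

Lemma models_conj_all (R : realType) (S : network R) (z : signal S)
    (phi : 'I_(nsub S) -> stl S) :
  models z (conj_all phi) <-> forall i, models z (phi i).
Proof.
(* [SAnd] is a syntax constructor and obeys no monoid laws, so the iterated conjunction is unfolded
   by induction on an arbitrary index list. *)
suff sat_big (r : seq 'I_(nsub S)) :
    models z (\big[@SAnd R S/STop]_(i <- r) phi i) <->
    forall i, i \in r -> models z (phi i).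
  split=> [/sat_big zphi i|zphi]; first exact/zphi/mem_index_enum.
  by apply/sat_big => i _; exact: zphi.
elim: r => [|j r IHr]; first by rewrite big_nil; split.
rewrite big_cons; split=> [[zj /IHr zr] i|zphi].
  by rewrite inE => /predU1P[->|/zr].
split; first by apply: zphi; rewrite mem_head.
by apply/IHr => i ir; apply: zphi; rewrite inE ir orbT.
Qed.

Theorem theorem1 (R : realType) (S : network R) (C : contract S)
  (Hsub : forall (i : 'I_(nsub S))
    (pae_i : local_param (cae C) i) (paf_i : local_param (caf C) i),
    subsystem_le i (SAnd (phi_ae pae_i) (phi_af paf_i))
                   (phi_g (lambda (pae_i, paf_i))))
  (Gamma : overall_g C -> overall_param (caf C))
  (HGamma : forall (pg : overall_g C) (i : 'I_(nsub S)),
    stl_le (Phi_g pg) (phi_af (proj i (Gamma pg))))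
  (pae : overall_param (cae C)) (paf0 : overall_param (caf C)) :
  forall z : signal S, trajectory z ->
    models z (Phi_ae pae) -> models z (Phi_af paf0) ->
    forall k : nat, models z (Phi_g (pg_seq pae Gamma paf0 k)).
Proof.
move=> z ztraj /models_conj_all zae /models_conj_all zaf0 k.
(* The round is stated for arbitrary [paf], to serve both [paf0] and the values of [Gamma]. Its
   premise is componentwise because [HGamma] yields one index at a time. *)
suff zg paf : (forall i, models z (phi_af (proj i paf))) ->
    models z (Phi_g (hat_Lambda pae paf)).
  elim: k => [|k IHk]; first exact: zg.
  by apply: zg => i; exact: HGamma IHk.
move=> zaf; apply/models_conj_all => i.
by apply: Hsub (ztraj i) _; split; [exact: zae|exact: zaf].
Qed.
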